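(* For every integer $n\ge 0$, there is a bijection between the set of isomorphism classes of $XY$-graphs on $n$ vertices and the set of isomorphism classes of unbalanced split graphs on $n+1$ vertices.
   Context: An $XY$-graph is a bipartite graph together with a specified ordered bipartition $X\cup Y$ of its vertex set (every edge joins a vertex of $X$ to a vertex of $Y$; $X$ is the distinguished part; $X$ or $Y$ may be empty). Two $XY$-graphs are isomorphic if there is a graph isomorphism mapping $X$ onto $X'$ and $Y$ onto $Y'$. A finite graph $G$ is a split graph if its vertex set can be partitioned as $K\cup S$ with $K$ a clique and $S$ a stable set (a $KS$-partition). A split graph is balanced if it has a $KS$-partition with $|K|=\omega(G)$ (the clique number) and $|S|=\alpha(G)$ (the independence number), and unbalanced otherwise. Graphs are considered up to isomorphism. *)

(* Defs.v *)
From mathcomp Require Import all_boot.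

Set Implicit Arguments.
Unset Strict Implicit.
Unset Printing Implicit Defensive.

Record sgraph := SGraph {
  vertex :> finType;
  adj : rel vertex;
  adj_sym : symmetric adj;
  adj_irr : irreflexive adj
}.

Definition graph_iso_map (G H : sgraph) (f : G -> H) : Prop :=
  bijective f /\ (forall u v : G, adj (f u) (f v) = adj u v).

Definition graph_iso (G H : sgraph) : Prop :=
  exists f : G -> H, graph_iso_map f.

(* The ordered bipartition is given by its distinguished part X; the other
   part Y is the complement of X. Either part may be empty. *)
Record xygraph := XYGraph {
  xy_graph :> sgraph;
  partX : {set xy_graph};
  xy_bipartite :
    forall u v : xy_graph, adj u v -> (u \in partX) != (v \in partX)
}.

Definition partY (G : xygraph) : {set G} := ~: partX G.

Definition xy_iso (G H : xygraph) : Prop :=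
  exists f : G -> H,
    [/\ graph_iso_map f, f @: partX G = partX H & f @: partY G = partY H].

Section SplitGraphs.
Variable G : sgraph.
Implicit Types A K S : {set G}.

Definition clique A : bool :=
  [forall u in A, forall v in A, (u != v) ==> adj u v].

Definition stable A : bool :=
  [forall u in A, forall v in A, ~~ adj u v].

Definition clique_number : nat := \max_(A : {set G} | clique A) #|A|.

Definition independence_number : nat := \max_(A : {set G} | stable A) #|A|.

Definition KS_partition K S : Prop :=
  [/\ K :|: S = [set: G], [disjoint K & S], clique K & stable S].

Definition split_graph : Prop := exists K S, KS_partition K S.

Definition balanced : Prop :=
  exists K S,
    [/\ KS_partition K S, #|K| = clique_number & #|S| = independence_number].

Definition unbalanced_split_graph : Prop := split_graph /\ ~ balanced.

End SplitGraphs.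

(* Vertex types range over all finite types, so an isomorphism class is the
   predicate satisfied by exactly the graphs isomorphic to a given one. *)
Definition xy_classes (n : nat) : Type :=
  {C : xygraph -> Prop | exists2 G : xygraph, #|G| = n & C = xy_iso G}.

Definition unbalanced_split_classes (n : nat) : Type :=
  {C : sgraph -> Prop |
    exists G : sgraph,
      [/\ unbalanced_split_graph G, #|G| = n & C = graph_iso G]}.

(* Main.v *)
Require Import Defs.
From mathcomp Require Import all_boot.
From mathcomp Require Import perm boolp.

Set Implicit Arguments.
Unset Strict Implicit.
Unset Printing Implicit Defensive.

(** A split graph is unbalanced exactly when it has a swing vertex: a vertex
    lying both in a clique K and in a stable set S that together cover the
    graph.  An XY-graph is turned into an unbalanced split graph by making X a
    clique and adding a swing vertex adjacent to exactly X.  Conversely,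
    deleting a swing vertex w and the edges inside its neighbourhood recovers
    the XY-graph, with X the neighbourhood of w.  The choice of w is immaterial
    because any two swing vertices have the same neighbours apart from each
    other, so that transposing them is an automorphism. *)

(** * Isomorphisms of graphs and of XY-graphs *)

Lemma graph_iso_refl (G : sgraph) : graph_iso G G.
Proof. by exists id; split=> //; exists id. Qed.

Lemma graph_iso_sym (G H : sgraph) : graph_iso G H -> graph_iso H G.
Proof.
move=> [f [[g fK gK] fadj]]; exists g; split; first by exists f.
by move=> u v; rewrite -fadj !gK.
Qed.

Lemma graph_iso_trans (G H I : sgraph) :
  graph_iso G H -> graph_iso H I -> graph_iso G I.
Proof.
move=> [f [fbij fadj]] [g [gbij gadj]]; exists (g \o f); split.
  exact: bij_comp.
by move=> u v; rewrite /= gadj fadj.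
Qed.

Lemma graph_iso_card (G H : sgraph) : graph_iso G H -> #|G| = #|H|.
Proof. by move=> [f [fbij _]]; apply: bij_eq_card fbij. Qed.

(** As [partY] is the complement of [partX] and the map is bijective, one membership condition on
    [partX] handles both parts. *)
Lemma xy_isoP (G H : xygraph) :
  xy_iso G H <->
  exists2 f : G -> H,
    graph_iso_map f & forall u, (f u \in partX H) = (u \in partX G).
Proof.
split=> [[f [fiso fX _]] | [f fiso fX]]; exists f => //.
  by move=> u; rewrite -fX mem_imset //; apply: bij_inj fiso.1.
have [[g fK gK] _] := fiso.
have fim (A : {set G}) (B : {set H}) :
    (forall u, (f u \in B) = (u \in A)) -> f @: A = B.
  move=> fAB; apply/setP=> v; apply/imsetP/idP => [[u uA ->]|vB].
    by rewrite fAB.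
  by exists (g v); rewrite ?gK // -fAB gK.
by split=> //; apply: fim => // u; rewrite !inE fX.
Qed.

Lemma xy_iso_refl (G : xygraph) : xy_iso G G.
Proof. by apply/xy_isoP; exists id => //; split=> //; exists id. Qed.

Lemma setUDl (T : finType) (A B : {set T}) : A :|: B :\: A = A :|: B.
Proof. by apply/setP=> x; rewrite !inE; case: (x \in A). Qed.

(** * Swing vertices and unbalancedness *)

Section Swing.
Variable G : sgraph.
Implicit Types (A K S : {set G}) (u v w : G).

Lemma cliqueP A :
  reflect {in A &, forall u v, u != v -> adj u v} (clique A).
Proof.
apply: (iffP forall_inP) => [cA u v uA vA uv | cA u uA].
  by have /forall_inP/(_ v vA)/implyP := cA u uA; apply.
by apply/forall_inP=> v vA; apply/implyP; apply: cA.
Qed.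

Lemma stableP A : reflect {in A &, forall u v, ~~ adj u v} (stable A).
Proof.
apply: (iffP forall_inP) => [sA u v uA vA | sA u uA].
  by have /forall_inP/(_ v vA) := sA u uA.
by apply/forall_inP=> v vA; apply: sA.
Qed.

Definition swing w : Prop :=
  exists K S, [/\ K :|: S = [set: G], w \in K, w \in S, clique K & stable S].

Lemma clique_stableI K S : clique K -> stable S -> #|K :&: S| <= 1.
Proof.
move=> /cliqueP cK /stableP sS; apply/card_le1_eqP=> u v.
rewrite !inE => /andP[uK uS] /andP[vK vS].
by apply/eqP; apply: contraT => uv; have := sS v u vS uS; rewrite cK.
Qed.

(** Outside [K], the set [A] lies in [S]. Since it has at most one vertex in [K] but is larger than
    [S], it must contain all of [S :\: K] and exactly one vertex of [K]. The statement is neutral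
    between cliques and stable sets, so it serves both. *)
Lemma setU_exchange K S A :
  K :|: S = [set: G] -> #|K :&: A| <= 1 -> #|S| < #|A| ->
  (exists2 w, w \in K & w \in A) /\ K :|: A = [set: G].
Proof.
move=> KST KA1 ltSA.
have subD : A :\: K \subset S :\: K.
  apply/subsetP=> u; rewrite !inE => /andP[uK _]; rewrite uK /=.
  by have := in_setT u; rewrite -KST inE (negbTE uK).
have cA := cardsID K A; rewrite setIC in cA.
have leD := subset_leq_card subD.
have leS := subset_leq_card (subsetDl S K).
have eqD : A :\: K = S :\: K.
  apply/eqP; rewrite eqEcard subD -ltnS.
  apply: leq_ltn_trans leS _; apply: leq_trans ltSA _.
  by rewrite -cA -add1n leq_add2r.
split; last by rewrite -KST -[LHS]setUDl eqD setUDl.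
have /card_gt0P[w] : 0 < #|K :&: A|.
  rewrite lt0n; apply: contraTneq ltSA => KA0.
  by rewrite -leqNgt -cA KA0 (leq_trans leD).
by rewrite inE => /andP[wK wA]; exists w.
Qed.

Lemma unbalanced_swing : unbalanced_split_graph G -> exists w, swing w.
Proof.
move=> [[K [S [KST dKS cK sS]]] nbal]; apply: contrapT => nsw; case: nbal.
(* Without swing vertices the given partition is itself balanced: a larger clique or stable set [A]
   could be exchanged for [K] or [S], giving a cover whose two sets meet. *)
exists K, S; split=> //; apply/eqP; rewrite eqn_leq leq_bigmax_cond //=;
  apply/bigmax_leqP=> A hA; rewrite leqNgt; apply/negP=> ltA; apply: nsw.
- rewrite setUC in KST.
  have [|[w wS wA] SAT] := setU_exchange KST _ ltA.
    by rewrite setIC clique_stableI.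
  by exists w, A, S; rewrite setUC.
- have [|[w wK wA] KAT] := setU_exchange KST _ ltA.
    by rewrite clique_stableI.
  by exists w, K, A.
Qed.

(** The overlapping cover has total size above [#|G|], whereas a balanced partition would have total
    size [#|G|] with both parts at least as large. *)
Lemma swing_unbalanced w : swing w -> unbalanced_split_graph G.
Proof.
move=> [K [S [KST wK wS cK sS]]]; split.
  exists K, (S :\: K); split=> //; first by rewrite setUDl.
    by rewrite -setI_eq0 setIDA setDIl setDv set0I.
  by apply/stableP=> u v /setDP[uS _] /setDP[vS _]; apply: (stableP _ sS).
move=> [K' [S' [[KST' dKS' _ _] cK' cS']]].
have leK : #|K| <= #|K'| by rewrite cK' leq_bigmax_cond.
have leS : #|S| <= #|S'| by rewrite cS' leq_bigmax_cond.
have := cardsUI K S; have := cardsUI K' S'.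
rewrite KST KST' (disjoint_setI0 dKS') cards0 addn0 => -> eqc.
have := leq_add leK leS; rewrite -eqc -[leqRHS]addn0 leq_add2l leqNgt.
by move/negP; apply; apply/card_gt0P; exists w; rewrite inE wK.
Qed.

Lemma swing_adj w u v :
  swing w -> swing v -> u != v -> adj w u -> adj v u.
Proof.
move=> [K [S [KST wK wS /cliqueP cK /stableP sS]]].
move=> [K' [S' [KST' vK vS /cliqueP cK' /stableP sS']]] uv wu.
have cov x : x \notin K' -> x \in S'.
  by have := in_setT x; rewrite -KST' inE => /orP[->|].
have covS x : adj w x -> x \in K.
  have := in_setT x; rewrite -KST inE => /orP[//|xS].
  by rewrite (negbTE (sS _ _ wS xS)).
apply: contraT => nvu.
have uS' : u \in S' 
  by apply/cov; apply: contra nvu => uK'; rewrite cK' // eq_sym.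
have [wv|wv] := eqVneq w v; first by rewrite -wv wu in nvu.
have wK' : w \in K'.
  by apply: contraT => /cov wS'; rewrite (negbTE (sS' _ _ wS' uS')) in wu.
(* Both [w] and [v] lie in the clique [K'], so [v] is a neighbour of [w]; [K] then contains both [u]
   and [v]. *)
have vinK : v \in K by apply: covS; apply: cK'.
by rewrite cK // ?covS // eq_sym in nvu.
Qed.

Lemma swing_tperm w v : swing w -> swing v -> graph_iso_map (tperm w v).
Proof.
move=> sw sv; split; first by exists (tperm w v); apply: tpermK.
have twin x : x != w -> x != v -> adj w x = adj v x.
  by move=> xw xv; apply/idP/idP; apply: swing_adj.
move=> x y; case: tpermP => [->|->|/eqP xw /eqP xv];
  case: tpermP => [->|->|/eqP yw /eqP yv]; rewrite ?adj_irr //.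
- exact: adj_sym.
- by rewrite twin.
- exact: adj_sym.
- by rewrite twin.
- by rewrite !(adj_sym x) twin.
- by rewrite !(adj_sym x) twin.
Qed.

End Swing.

Lemma swing_iso (G H : sgraph) (f : G -> H) w :
  graph_iso_map f -> swing w -> swing (f w).
Proof.
move=> [[g fK gK] fadj] [K [S [KST wK wS /cliqueP cK /stableP sS]]].
exists (g @^-1: K), (g @^-1: S); split; rewrite ?inE ?fK //.
- by rewrite -preimsetU KST preimsetT.
- apply/cliqueP=> x y; rewrite !inE -{3}(gK x) -{3}(gK y) fadj => xK yK xy.
  by apply: cK => //; rewrite (can_eq gK).
- apply/stableP=> x y; rewrite !inE -{2}(gK x) -{2}(gK y) fadj.
  exact: sS.
Qed.

(** * Adding a swing vertex *)

Section SwingExtension.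
Variable H : xygraph.

(** [None] is the new swing vertex; the guard [x != y] excludes loops on [partX]. *)
Definition swing_ext_adj (a b : option H) : bool :=
  match a, b with
  | None, None => false
  | None, Some x | Some x, None => x \in partX H
  | Some x, Some y =>
      adj x y || [&& x != y, x \in partX H & y \in partX H]
  end.

Lemma swing_ext_adj_sym : symmetric swing_ext_adj.
Proof.
by case=> [x|] [y|] //=; rewrite adj_sym eq_sym [(x \in _) && _]andbC.
Qed.

Lemma swing_ext_adj_irr : irreflexive swing_ext_adj.
Proof. by case=> [x|] //=; rewrite adj_irr eqxx. Qed.

Definition swing_ext : sgraph := SGraph swing_ext_adj_sym swing_ext_adj_irr.

Lemma swing_ext_None : swing (None : swing_ext).
Proof.
exists [set a : swing_ext | if a is Some x then x \in partX H else true].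
exists [set a : swing_ext | if a is Some x then x \notin partX H else true].
split; rewrite ?inE //.
- by apply/setP=> -[x|]; rewrite !inE ?orbN.
- apply/cliqueP=> -[x|] [y|]; rewrite !inE //= => xX yX xy.
  by apply/orP; right; rewrite xX yX !andbT.
- apply/stableP=> -[x|] [y|]; rewrite !inE //= => xX yX.
  rewrite (negbTE xX) andbF orbF; apply/negP=> /xy_bipartite.
  by rewrite (negbTE xX) (negbTE yX).
Qed.

(** The added edges between old vertices stay inside [partX], while the original ones cross, so [H]
    can be read off from its extension. *)
Lemma xy_adjE (x y : H) :
  adj x y = adj (Some x : swing_ext) (Some y)
            && ((x \in partX H) != (y \in partX H)).
Proof.
rewrite /=; case Exy: (adj x y) => /=; first by rewrite (xy_bipartite Exy).
by case: (x \in _) (y \in _) => -[]; rewrite !andbF.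
Qed.

End SwingExtension.

Lemma swing_ext_iso (H H' : xygraph) :
  xy_iso H H' -> graph_iso (swing_ext H) (swing_ext H').
Proof.
move=> /xy_isoP[f [[g fK gK] fadj] fX].
exists (omap f : swing_ext H -> swing_ext H'); split.
  by exists (omap g); apply: omapK.
by case=> [x|] [y|] //=; rewrite ?fadj ?fX ?(can_eq fK).
Qed.

Lemma swing_ext_iso_inv (H H' : xygraph) :
  graph_iso (swing_ext H) (swing_ext H') -> xy_iso H H'.
Proof.
move=> [f0 f0iso].
(* An isomorphism may send [None] to another swing vertex; a transposition of swing vertices
   corrects this. *)
have [f [[g fK gK] fadj] fN] :
    exists2 f : swing_ext H -> swing_ext H', graph_iso_map f & f None = None.
  have [tbij tadj] := swing_tperm (swing_iso f0iso (swing_ext_None H))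
                                  (swing_ext_None H').
  exists (tperm (f0 None) None \o f0); last by rewrite /= tpermL.
  split; first exact: bij_comp tbij f0iso.1.
  by move=> u v; rewrite /= [LHS]tadj f0iso.2.
have gN : g None = None by rewrite -fN fK.
have /fin_all_exists[h hE] x : exists y, f (Some x) = Some y.
  case E: (f (Some x)) => [y|]; first by exists y.
  by have := fK (Some x); rewrite E gN.
have /fin_all_exists[k kE] y : exists x, g (Some y) = Some x.
  case E: (g (Some y)) => [x|]; first by exists x.
  by have := gK (Some y); rewrite E fN.
(* [partX] is the neighbourhood of [None], which [f] fixes. *)
have hX x : (h x \in partX H') = (x \in partX H).
  by have := fadj None (Some x); rewrite fN hE.
apply/xy_isoP; exists h => //; split.
  exists k => z; apply: Some_inj; first by rewrite -kE -hE fK.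
  by rewrite -hE -kE gK.
by move=> x y; rewrite xy_adjE !hX -!hE fadj -xy_adjE.
Qed.

(** * Deleting a swing vertex *)

Section SwingDeletion.
Variables (G : sgraph) (w : G) (K : {set G}).

Local Notation vT := {v : G | v != w}.

(** Keeping only the edges that cross [K] makes the result bipartite by construction. *)
Definition swing_del_adj (u v : vT) : bool :=
  adj (val u) (val v) && ((val u \in K) != (val v \in K)).

Lemma swing_del_adj_sym : symmetric swing_del_adj.
Proof. by move=> u v; rewrite /swing_del_adj adj_sym eq_sym. Qed.

Lemma swing_del_adj_irr : irreflexive swing_del_adj.
Proof. by move=> u; rewrite /swing_del_adj adj_irr. Qed.

Definition swing_del_graph : sgraph :=
  SGraph swing_del_adj_sym swing_del_adj_irr.

Definition swing_del_partX : {set swing_del_graph} :=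
  [set u : vT | val u \in K].

Lemma swing_del_bipartite (u v : swing_del_graph) :
  adj u v -> (u \in swing_del_partX) != (v \in swing_del_partX).
Proof. by rewrite !inE => /andP[]. Qed.

Definition swing_del : xygraph := XYGraph swing_del_bipartite.

Lemma swing_ext_del (S : {set G}) :
  K :|: S = [set: G] -> w \in K -> w \in S -> clique K -> stable S ->
  graph_iso (swing_ext swing_del) G.
Proof.
move=> KST wK wS /cliqueP cK /stableP sS.
have cov x : x \notin K -> x \in S.
  by have := in_setT x; rewrite -KST inE => /orP[->|].
(* Being in both [K] and [S], the vertex [w] sees all the rest of [K] and nothing outside it. *)
have wadj (u : vT) : adj w (val u) = (val u \in K).
  apply/idP/idP => [|uK]; last by apply: cK; rewrite // eq_sym (valP u).
  by apply: contraTT => /cov; apply: sS.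
exists (oapp val w : swing_ext swing_del -> G); split.
  exists (insub : G -> option vT).
    by case=> [u|] /=; rewrite ?valK ?insubF ?eqxx.
  by move=> x; case: insubP => [u _ <-|/negPn/eqP->].
case=> [u|] [v|] //=; rewrite ?inE ?adj_irr ?wadj //;
  last by rewrite adj_sym wadj.
rewrite /swing_del_adj -val_eqE /=.
(* Two vertices of [K] regain their edge, crossing pairs are unchanged, and two vertices outside [K]
   lie in [S]. *)
have [uK|/cov uS] := boolP (val u \in K);
  have [vK|/cov vS] := boolP (val v \in K);
  rewrite /= ?andbT ?andbF ?orbF //.
  by have [->|/cK->] := eqVneq (val u) (val v); rewrite ?adj_irr.
by apply/negbTE/sS.
Qed.

End SwingDeletion.

Lemma unbalanced_swing_ext (G : sgraph) :
  unbalanced_split_graph G -> exists H, graph_iso (swing_ext H) G.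
Proof.
move=> /unbalanced_swing[w [K [S [KST wK wS cK sS]]]].
by exists (swing_del w K); apply: swing_ext_del KST wK wS cK sS.
Qed.

Lemma card_swing_ext (H : xygraph) : #|swing_ext H| = #|H|.+1.
Proof. exact: card_option. Qed.

(** * The bijection between classes *)

Definition ext_class (C : xygraph -> Prop) (G : sgraph) : Prop :=
  exists2 H, C H & graph_iso (swing_ext H) G.

(** Pulling [D] back along [swing_ext] avoids choosing a representative and a swing vertex in it. *)
Definition del_class (D : sgraph -> Prop) (H : xygraph) : Prop :=
  D (swing_ext H).

Lemma ext_class_xy_iso (H : xygraph) :
  ext_class (xy_iso H) = graph_iso (swing_ext H).
Proof.
apply/funext=> G; apply/propext; split=> [[H' HH' H'G]|HG].
  exact: graph_iso_trans (swing_ext_iso HH') H'G.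
by exists H => //; apply: xy_iso_refl.
Qed.

Lemma del_class_graph_iso (G : sgraph) (H : xygraph) :
  graph_iso (swing_ext H) G -> del_class (graph_iso G) = xy_iso H.
Proof.
move=> HG; apply/funext=> H'; apply/propext; split=> [GH'|HH'].
  exact/swing_ext_iso_inv/(graph_iso_trans HG).
exact: graph_iso_trans (graph_iso_sym HG) (swing_ext_iso HH').
Qed.

Theorem theorem3p2 (n : nat) :
  exists f : xy_classes n -> unbalanced_split_classes n.+1, bijective f.
Proof.
have fP (C : xy_classes n) : exists G : sgraph,
    [/\ unbalanced_split_graph G, #|G| = n.+1
      & ext_class (sval C) = graph_iso G].
  case: C => C /= [H Hn ->]; exists (swing_ext H); split.
  - exact: swing_unbalanced (swing_ext_None H).
  - by rewrite card_swing_ext Hn.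
  - exact: ext_class_xy_iso.
have gP (D : unbalanced_split_classes n.+1) : exists2 H : xygraph,
    #|H| = n & del_class (sval D) = xy_iso H.
  case: D => D /= [G [Gunb Gn ->]].
  have [H HG] := unbalanced_swing_ext Gunb; exists H.
    by apply: succn_inj; rewrite -card_swing_ext -Gn; apply: graph_iso_card.
  exact: del_class_graph_iso.
exists (fun C => exist _ (ext_class (sval C)) (fP C)).
exists (fun D => exist _ (del_class (sval D)) (gP D)).
(* Classes are equal once their predicates are, by proof irrelevance. *)
- case=> C CP; apply: eq_exist => /=; case: CP => H _ ->.
  by rewrite ext_class_xy_iso; apply: del_class_graph_iso (graph_iso_refl _).
- case=> D DP; apply: eq_exist => /=; case: DP => G [Gunb _ ->].
  have [H HG] := unbalanced_swing_ext Gunb.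
  rewrite (del_class_graph_iso HG) ext_class_xy_iso.
  apply/funext=> G'; apply/propext.
  by split; apply: graph_iso_trans => //; apply: graph_iso_sym.
Qed.
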